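(* Let $z\in\Sigma$. 1. The normalized left child $W_L(z)$ is given by the intersection of the geodesic $\Gamma$ with the ray issued from $0$ and passing through $z$, up to the normalization symmetry. 2. The normalized right child $W_R(z)$ is given by the intersection of $\Gamma$ with the ray issued from $1$ and passing through $z$, up to the same symmetry. 3. The formulas for $W_L(z)$ and $W_R(z)$ are given by \[ W_L(z)=\begin{cases}\dfrac{z+\bar z}{2z}, & \Re(z)\le\Im(z),\\[2ex] \dfrac{z-\bar z}{2z}, & \Re(z)>\Im(z),\end{cases} \qquad W_R(z)=\begin{cases}\dfrac{z+\bar z-2}{2(z-1)}, & 1-\Re(z)\le\Im(z),\\[2ex] \dfrac{z-\bar z}{2(z-1)}, & 1-\Re(z)>\Im(z).\end{cases} \]
   Context: Shape space: $\Sigma=\{z\in\mathbb C: 0<\Re(z)\le\tfrac12,\ \Im(z)>0,\ |z-1|\le1\}$, endowed with the Poincaré metric of the upper half-plane. Every similarity class of nondegenerate triangles is represented by a unique point $z\in\Sigma$, namely by the triangle with vertices $0,1,z$, obtained by normalizing so that the longest edge is the unit segment $[0,1]$, the third vertex lies in the upper half-plane, and the shortest edge is attached to $0$. Right triangles are represented by the hyperbolic geodesic $\Gamma=\{z\in\Sigma: |z-\tfrac12|=\tfrac12\}$. Longest-edge altitude bisection (LEAB): a triangle is subdivided into two triangles by the altitude dropped from the vertex opposite its longest edge. The left (right) child is the one sharing the left (right) endpoint of the longest edge; for the triangle with vertices $0,1,z$, $z\in\Sigma$, the left child has vertices $0,\Re(z),z$ and the right child has vertices $1,\Re(z),z$.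 The maps $W_L,W_R:\Sigma\to\Sigma$ send $z$ to the normalization of its left and right child, respectively. ''Up to the normalization symmetry'': the ray is intersected with the full semicircle $\{w: |w-\tfrac12|=\tfrac12,\ \Im(w)>0\}$ extending $\Gamma$, and if the intersection point $w$ has $\Re(w)>\tfrac12$ it is replaced by its reflection $1-\bar w$ in the line $\Re(w)=\tfrac12$, so that the shortest edge is attached to $0$.
   Formalization: The printed formulas for W_L when Re(z) ≤ Im(z) and for W_R when 1−Re(z) > Im(z) have negative imaginary part, so lie outside Σ; the formal statement replaces each of these two expressions by its complex conjugate. *)

(* Defs.v *)
From Stdlib Require Import Reals List Permutation ClassicalEpsilon.
From Coquelicot Require Import Coquelicot.
Import ListNotations.
Open Scope R_scope.
Open Scope C_scope.

Definition Sigma (z : C) : Prop :=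
  (0 < Re z <= 1 / 2)%R /\ (0 < Im z)%R /\ (Cmod (z - 1) <= 1)%R.

Definition Gamma (z : C) : Prop :=
  Sigma z /\ Cmod (z - (1 / 2)%R) = (1 / 2)%R.

(** The order in which the vertices are listed is immaterial: see [similar]. *)
Definition triangle : Type := (C * C * C)%type.

Definition vertices (T : triangle) : list C :=
  let '(a, b, c) := T in [a; b; c].

(** Similarities of the plane, orientation-reversing ones included. *)
Definition is_similarity (f : C -> C) : Prop :=
  exists r : R, (0 < r)%R /\
    forall u v : C, Cmod (f u - f v) = (r * Cmod (u - v))%R.

Definition similar (T T' : triangle) : Prop :=
  exists f : C -> C,
    is_similarity f /\ Permutation (map f (vertices T)) (vertices T').

(** For [w] in [Sigma], the longest edge of the triangle [0, 1, w] is [0, 1],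
    its third vertex is in the upper half-plane and its shortest edge is
    attached to [0]. A nondegenerate triangle is similar to exactly one such
    triangle; the value is unspecified on degenerate triples. *)
Definition normalize (T : triangle) : C :=
  epsilon (inhabits (RtoC 0))
    (fun w : C => Sigma w /\ similar T (RtoC 0, RtoC 1, w)).

(** [RtoC (Re z)] is the foot of the altitude from [z] to the edge [0, 1]. *)
Definition left_child (z : C) : triangle := (RtoC 0, RtoC (Re z), z).
Definition right_child (z : C) : triangle := (RtoC 1, RtoC (Re z), z).

Definition W_L (z : C) : C := normalize (left_child z).
Definition W_R (z : C) : C := normalize (right_child z).

Definition ray (p q u : C) : Prop :=
  exists t : R, (0 <= t)%R /\ u = p + t * (q - p).

Definition semicircle (w : C) : Prop :=
  Cmod (w - (1 / 2)%R) = (1 / 2)%R /\ (0 < Im w)%R.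

(** Reflection in the line [Re w = 1/2] when [w] lies to its right. *)
Definition fold_half (w : C) : C :=
  if Rlt_dec (1 / 2) (Re w) then 1 - Cconj w else w.

(* Main.v *)
Require Import Defs.
From Stdlib Require Import Reals Lra List Permutation ClassicalEpsilon.
From Coquelicot Require Import Coquelicot.
Import ListNotations.
Open Scope R_scope.
Open Scope C_scope.

(** A similarity, orientation-preserving or reversing, does not change the
    ratios of the side lengths, and a point of [Sigma] is determined by the
    lengths of the sides of its triangle; hence to compute a normalization it
    suffices to exhibit one similarity onto a triangle [0, 1, w] with [w] in
    [Sigma]. Both children are right triangles, with legs [p <= q] say, and
    the right angle puts [w] on [Gamma] (Thales), at the point
    [(p^2 + p q i) / (p^2 + q^2)]. The two rays meet the semicircle in a point
    of the same form, but with [p] and [q] in either order; exchanging them is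
    the reflection [w -> 1 - conj w]. *)

(** * Side lengths under similarity *)

Definition sides (T : Defs.triangle) : list R :=
  let '(a, b, c) := T in [Cmod (a - b); Cmod (b - c); Cmod (a - c)].

Lemma Permutation_3_iff (A : Type) (a b c x y z : A) :
  Permutation [a; b; c] [x; y; z] <->
  (a = x /\ b = y /\ c = z) \/ (a = x /\ b = z /\ c = y) \/
  (a = y /\ b = x /\ c = z) \/ (a = y /\ b = z /\ c = x) \/
  (a = z /\ b = x /\ c = y) \/ (a = z /\ b = y /\ c = x).
Proof.
split.
- intros H.
  (* Locating [a] in the target list leaves a permutation of two elements. *)
  destruct (Permutation_vs_cons_inv (Permutation_sym H)) as (l1 & l2 & E).
  rewrite E in H.
  apply Permutation_cons_app_inv, Permutation_length_2_inv in H.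
  destruct l1 as [|u [|v [|t l1]]]; simpl in E; injection E; intros; subst;
    simpl in H; try (destruct H as [H | H]; injection H; intros; subst; tauto).
  destruct l1; discriminate.
- intros [(-> & -> & ->)|[(-> & -> & ->)|[(-> & -> & ->)
     |[(-> & -> & ->)|[(-> & -> & ->)|(-> & -> & ->)]]]]].
  + reflexivity.
  + apply perm_skip, perm_swap.
  + apply perm_swap.
  + symmetry; apply (Permutation_cons_append [y; z] x).
  + apply (Permutation_cons_append [x; y] z).
  + apply (Permutation_rev [z; y; x]).
Qed.

Lemma Cmod_sub_comm (u v : C) : Cmod (u - v) = Cmod (v - u).
Proof. rewrite <- (Cmod_opp (u - v)); f_equal; ring. Qed.

Lemma Permutation_sides (a b c x y z : C) :
  Permutation [a; b; c] [x; y; z] ->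
  Permutation (sides (a, b, c)) (sides (x, y, z)).
Proof.
intros H; unfold sides.
apply Permutation_3_iff in H; apply Permutation_3_iff.
destruct H
  as [(-> & -> & ->)|[(-> & -> & ->)|[(-> & -> & ->)
     |[(-> & -> & ->)|[(-> & -> & ->)|(-> & -> & ->)]]]]];
  rewrite ?(Cmod_sub_comm y x), ?(Cmod_sub_comm z y), ?(Cmod_sub_comm z x);
  tauto.
Qed.

Lemma similar_sides (T T' : Defs.triangle) :
  similar T T' ->
  exists r : R, (0 < r)%R /\ Permutation (map (Rmult r) (sides T)) (sides T').
Proof.
destruct T as [[a b] c], T' as [[x y] z].
intros (f & (r & r0 & fr) & P); exists r; split; [exact r0|].
apply Permutation_sides in P; simpl in *; now rewrite <- !fr.
Qed.

(** * Moduli in coordinates and uniqueness of the representative in [Sigma] *)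

Lemma pow2_Cmod (z : C) : (Cmod z ^ 2 = Re z ^ 2 + Im z ^ 2)%R.
Proof.
unfold Cmod; rewrite pow2_sqrt; [reflexivity|].
generalize (pow2_ge_0 (fst z)) (pow2_ge_0 (snd z)); lra.
Qed.

Lemma Cmod_le_iff (z w : C) :
  (Cmod z <= Cmod w <-> Re z ^ 2 + Im z ^ 2 <= Re w ^ 2 + Im w ^ 2)%R.
Proof.
rewrite <- !pow2_Cmod; generalize (Cmod_ge_0 z) (Cmod_ge_0 w).
intros; split; nra.
Qed.

Lemma Cmod_eq_iff (z : C) (r : R) :
  (0 <= r)%R -> (Cmod z = r <-> Re z ^ 2 + Im z ^ 2 = r ^ 2)%R.
Proof.
intros r0; rewrite <- pow2_Cmod; split; [now intros ->|].
intros E; apply Rsqr_inj; [apply Cmod_ge_0|exact r0|unfold Rsqr; lra].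
Qed.

Lemma Sigma_sides (w : C) :
  Sigma w -> (Cmod w <= Cmod (1 - w) <= 1)%R.
Proof.
intros ((_ & h) & _ & k); rewrite (Cmod_sub_comm 1 w); split; [|exact k].
apply Cmod_le_iff; destruct w; simpl in *; nra.
Qed.

(** Both side lists are proportional to that of [T], hence to each other; the longest side is 1 in
    both, so the ratio is 1. The order of the sides then matches them one by one, and the distances
    to 0 and 1 fix a point of the upper half-plane. *)
Lemma similar_Sigma_unique (T : Defs.triangle) (w w' : C) :
  Sigma w -> similar T (RtoC 0, RtoC 1, w) ->
  Sigma w' -> similar T (RtoC 0, RtoC 1, w') -> w = w'.
Proof.
intros Sw (r & r0 & P)%similar_sides Sw' (r' & r0' & P')%similar_sides.
(* After this rescaling [P] and [P'] start from the same list. *)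
apply (Permutation_map (Rmult (r' / r))) in P.
rewrite map_map, (map_ext _ (Rmult r')) in P by (intros; field; lra).
assert (c0 : (0 < r' / r)%R) by now apply Rdiv_lt_0_compat.
revert c0 P; generalize (r' / r)%R; intros c c0 P.
apply Permutation_sym in P.
generalize (perm_trans P P'); clear - c0 Sw Sw'; intros P.
assert (E : Cmod w = Cmod w' /\ Cmod (1 - w) = Cmod (1 - w')).
{ generalize (Sigma_sides _ Sw) (Sigma_sides _ Sw').
  unfold sides in P; simpl in P.
  assert (E01 : Cmod (0 - 1) = 1%R)
    by (rewrite Cmod_sub_comm; replace (1 - 0) with (RtoC 1) by ring; apply Cmod_1).
  rewrite E01, (Cmod_sub_comm 0 w), (Cmod_sub_comm 0 w') in P.
  replace (w - 0) with w in P by ring; replace (w' - 0) with w' in P by ring.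
  apply Permutation_3_iff in P; rewrite Rmult_1_r in P.
  intros H H'.
  assert (c = 1%R) as -> by (apply Rle_antisym; decompose [and or] P; nra).
  decompose [and or] P; lra. }
destruct E as [E1 E2].
apply (f_equal (fun t => t ^ 2)%R) in E1, E2; rewrite !pow2_Cmod in E1, E2.
destruct Sw as (_ & Iw & _), Sw' as (_ & Iw' & _), w as [a b], w' as [a' b'].
simpl in *.
(* Subtracting the two equations cancels the squares; the imaginary parts then agree by their
   sign. *)
assert (a = a') as -> by lra.
f_equal; nra.
Qed.

Lemma normalize_eq (T : Defs.triangle) (w : C) :
  Sigma w -> similar T (RtoC 0, RtoC 1, w) -> normalize T = w.
Proof.
intros Sw S.
destruct (epsilon_spec (inhabits (RtoC 0))
  (fun w : C => Sigma w /\ similar T (RtoC 0, RtoC 1, w))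
  (ex_intro _ w (conj Sw S))) as [Sn n].
exact (similar_Sigma_unique T _ _ Sn n Sw S).
Qed.

(** * Affine similarities and their conjugates *)

Lemma is_similarity_affine (a b : C) :
  a <> 0 -> is_similarity (fun u => a * u + b).
Proof.
intros a0; exists (Cmod a); split; [now apply Cmod_gt_0|].
intros u v; rewrite <- Cmod_mult; f_equal; ring.
Qed.

Lemma is_similarity_conj (f : C -> C) :
  is_similarity f -> is_similarity (fun u => Cconj (f u)).
Proof.
intros (r & r0 & fr); exists r; split; [exact r0|].
intros u v; rewrite <- fr, <- Cminus_conj; apply Cmod_conj.
Qed.

(** * Right triangles with hypotenuse from 0 to 1 *)

(** The apex of the right angle, over the hypotenuse [0, 1], of a right triangle
    whose legs at [0] and [1] are proportional to [p] and [q]. *)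
Definition right_apex (p q : R) : C :=
  ((p ^ 2 / (p ^ 2 + q ^ 2))%R, (p * q / (p ^ 2 + q ^ 2))%R).

Lemma right_apex_reflect (p q : R) :
  (0 < p)%R -> (0 < q)%R -> 1 - Cconj (right_apex p q) = right_apex q p.
Proof.
intros p0 q0; unfold right_apex, Cconj, Cminus, Cplus, Copp, RtoC; simpl.
f_equal; field; nra.
Qed.

Lemma right_apex_circle (p q : R) :
  (0 < p)%R -> (0 < q)%R -> semicircle (right_apex p q).
Proof.
intros p0 q0; split.
- apply Cmod_eq_iff; [lra|]; simpl; field; nra.
- simpl; apply Rdiv_lt_0_compat; nra.
Qed.

Lemma right_apex_Re_le (p q : R) :
  (0 < p)%R -> (0 < q)%R -> (Re (right_apex p q) <= 1 / 2 <-> p <= q)%R.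
Proof.
intros p0 q0; simpl.
(* One half minus the real part is [q - p] times a positive factor. *)
replace (p * (p * 1) / (p * (p * 1) + q * (q * 1)))%R
  with (1 / 2 - (q - p) * ((q + p) / (2 * (p ^ 2 + q ^ 2))))%R by (field; nra).
assert (0 < (q + p) / (2 * (p ^ 2 + q ^ 2)))%R by (apply Rdiv_lt_0_compat; nra).
split; nra.
Qed.

Lemma right_apex_Gamma (p q : R) :
  (0 < p <= q)%R -> Gamma (right_apex p q).
Proof.
intros [p0 pq].
assert (q0 : (0 < q)%R) by lra.
destruct (right_apex_circle p q p0 q0) as [c i].
assert (h := proj2 (right_apex_Re_le p q p0 q0) pq).
assert (r : (0 < Re (right_apex p q))%R)
  by (simpl; apply Rdiv_lt_0_compat; nra).
split; [|exact c]; split; [lra|split; [exact i|]].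
apply Cmod_eq_iff in c; [|lra].
(* On the circle, [(a - 1)^2 + b^2 = 1 - a], and [a] is positive. *)
rewrite <- Cmod_1 at 2; apply Cmod_le_iff.
revert c r; destruct (right_apex p q) as [a b]; simpl; intros; nra.
Qed.

Lemma fold_half_right_apex (p q : R) :
  (0 < p)%R -> (0 < q)%R ->
  fold_half (right_apex p q) = right_apex (Rmin p q) (Rmax p q).
Proof.
intros p0 q0; unfold fold_half.
assert (h := right_apex_Re_le p q p0 q0).
destruct (Rlt_dec _ _) as [l | l].
- assert (q < p)%R by (apply Rnot_le_lt; intros k; apply h in k; lra).
  rewrite Rmin_right, Rmax_left by lra; now apply right_apex_reflect.
- apply Rnot_lt_le, h in l; now rewrite Rmin_left, Rmax_right.
Qed.

(** * Normalization by explicit similarities *)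

(** The affine map sending [a] to 0 and [c] to 1 sends [b] to the quotient. *)
Lemma normalize_vertices (a b c : C) (T : Defs.triangle) :
  Permutation (vertices T) [a; b; c] -> c - a <> 0 ->
  Sigma ((b - a) / (c - a)) -> normalize T = (b - a) / (c - a).
Proof.
intros P ac S; apply normalize_eq; [exact S|].
exists (fun u => / (c - a) * u + - a / (c - a)); split.
- apply is_similarity_affine; intros E; apply C1_nz.
  now rewrite <- (Cinv_l (c - a) ac), E, Cmult_0_l.
- rewrite (Permutation_map _ P); apply Permutation_3_iff.
  (* The images come in the order 0, w, 1: the second of the six cases. *)
  right; left; repeat split; field; exact ac.
Qed.

Lemma Cconj_RtoC (r : R) : Cconj r = r.
Proof. unfold Cconj, RtoC; simpl; now rewrite Ropp_0. Qed.

(** Serves when the quotient falls in the lower half-plane and the triangle must be reflected. *)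
Lemma normalize_vertices_conj (a b c : C) (T : Defs.triangle) :
  Permutation (vertices T) [a; b; c] -> c - a <> 0 ->
  Sigma (Cconj ((b - a) / (c - a))) ->
  normalize T = Cconj ((b - a) / (c - a)).
Proof.
intros P ac S; apply normalize_eq; [exact S|].
exists (fun u => Cconj (/ (c - a) * u + - a / (c - a))); split.
- apply is_similarity_conj, is_similarity_affine; intros E; apply C1_nz.
  now rewrite <- (Cinv_l (c - a) ac), E, Cmult_0_l.
- rewrite (Permutation_map _ P); apply Permutation_3_iff.
  right; left; rewrite <- (Cconj_RtoC 0), <- (Cconj_RtoC 1).
  repeat split; f_equal; field; exact ac.
Qed.

Ltac complex_field :=
  unfold right_apex, Cconj, Cdiv, Cinv, Cmult, Cminus, Cplus, Copp, RtoC;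
  apply injective_projections; simpl; field; nra.

Lemma Im_neq_0 (z : C) : Im z <> 0%R -> z <> 0.
Proof. now intros h ->. Qed.

(** * The normalized children *)

(** The end of the hypotenuse on the shorter leg, here 0, goes to 0 and the other end to 1; this
    takes a reflection. *)
Lemma W_L_le (x y : R) :
  (0 < x <= y)%R -> W_L (x, y) = right_apex x y.
Proof.
intros h.
assert (E : right_apex x y = Cconj ((x - 0) / ((x, y) - 0)))
  by complex_field.
rewrite E; apply normalize_vertices_conj.
- reflexivity.
- apply Im_neq_0; simpl; lra.
- rewrite <- E; now apply right_apex_Gamma.
Qed.

(** The altitude is now the shorter leg, so [(x, y)] goes to 0, without reflection. *)
Lemma W_L_ge (x y : R) :
  (0 < y <= x)%R -> W_L (x, y) = right_apex y x.
Proof.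
intros h.
assert (E : right_apex y x = (x - (x, y)) / (0 - (x, y)))
  by complex_field.
rewrite E; apply normalize_vertices.
- apply Permutation_3_iff; simpl; tauto.
- apply Im_neq_0; simpl; lra.
- rewrite <- E; now apply right_apex_Gamma.
Qed.

(** The right child lies across the altitude, so the cases with and without reflection are
    exchanged. *)
Lemma W_R_le (x y : R) :
  (0 < 1 - x <= y)%R -> W_R (x, y) = right_apex (1 - x) y.
Proof.
intros h.
assert (E : right_apex (1 - x) y = (x - 1) / ((x, y) - 1))
  by complex_field.
rewrite E; apply normalize_vertices.
- reflexivity.
- apply Im_neq_0; simpl; lra.
- rewrite <- E; now apply right_apex_Gamma.
Qed.

Lemma W_R_ge (x y : R) :
  (0 < y <= 1 - x)%R -> W_R (x, y) = right_apex y (1 - x).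
Proof.
intros h.
assert (E : right_apex y (1 - x) = Cconj ((x - (x, y)) / (1 - (x, y))))
  by complex_field.
rewrite E; apply normalize_vertices_conj.
- apply Permutation_3_iff; simpl; tauto.
- apply Im_neq_0; simpl; lra.
- rewrite <- E; now apply right_apex_Gamma.
Qed.

Lemma W_L_apex (x y : R) :
  (0 < x)%R -> (0 < y)%R -> W_L (x, y) = right_apex (Rmin x y) (Rmax x y).
Proof.
intros x0 y0; destruct (Rle_dec x y).
- rewrite Rmin_left, Rmax_right by lra; apply W_L_le; lra.
- rewrite Rmin_right, Rmax_left by lra; apply W_L_ge; lra.
Qed.

(** The order of [y] and [1 - x] is that of the point where the ray from 1 meets the semicircle. *)
Lemma W_R_apex (x y : R) :
  (0 < 1 - x)%R -> (0 < y)%R ->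
  W_R (x, y) = right_apex (Rmin y (1 - x)) (Rmax y (1 - x)).
Proof.
intros x0 y0; destruct (Rle_dec y (1 - x)).
- rewrite Rmin_left, Rmax_right by lra; apply W_R_ge; lra.
- rewrite Rmin_right, Rmax_left by lra; apply W_R_le; lra.
Qed.

(** * Rays meeting the semicircle *)

Lemma ray_0_semicircle (x y : R) (u : C) :
  (0 < x)%R -> (0 < y)%R ->
  ray 0 (x, y) u /\ semicircle u <-> u = right_apex x y.
Proof.
intros x0 y0; split.
- intros ((t & t0 & ->) & c & i).
  apply Cmod_eq_iff in c; [|lra]; simpl in c, i.
  (* The circle equation reads [t^2 (x^2 + y^2) = t x]; a positive imaginary part excludes
     [t = 0]. *)
  assert (t = x / (x ^ 2 + y ^ 2))%R as ->.
  { apply Rmult_eq_reg_l with (t * (x ^ 2 + y ^ 2))%R; [|nra].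
    field_simplify; [|nra]; nra. }
  complex_field.
- intros ->; split; [|now apply right_apex_circle].
  exists (x / (x ^ 2 + y ^ 2))%R; split.
  + apply Rlt_le, Rdiv_lt_0_compat; nra.
  + complex_field.
Qed.

Lemma ray_reflect (z u : C) : ray 1 z u <-> ray 0 (1 - Cconj z) (1 - Cconj u).
Proof.
split; intros (t & t0 & E); exists t; (split; [exact t0|]).
- rewrite E; apply injective_projections; simpl; ring.
- apply (f_equal (fun v => 1 - Cconj v)) in E; destruct u, z.
  apply injective_projections;
    [apply (f_equal fst) in E | apply (f_equal snd) in E]; simpl in *; lra.
Qed.

Lemma semicircle_reflect (u : C) : semicircle u <-> semicircle (1 - Cconj u).
Proof.
unfold semicircle; rewrite !Cmod_eq_iff by lra; destruct u; simpl.
split; intros []; split; lra.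
Qed.

(** Reflection in the line [Re w = 1/2] reduces this to the ray from 0 through [(1 - x, y)]. *)
Lemma ray_1_semicircle (x y : R) (u : C) :
  (0 < 1 - x)%R -> (0 < y)%R ->
  ray 1 (x, y) u /\ semicircle u <-> u = right_apex y (1 - x).
Proof.
intros x0 y0; rewrite ray_reflect, semicircle_reflect.
replace (1 - Cconj (x, y)) with ((1 - x)%R, y)
  by (apply injective_projections; simpl; ring).
rewrite ray_0_semicircle, <- (right_apex_reflect y (1 - x)) by assumption.
split; [|now intros ->]; intros E.
apply (f_equal (fun v => 1 - Cconj v)) in E.
apply injective_projections;
  [apply (f_equal fst) in E | apply (f_equal snd) in E]; simpl in *; lra.
Qed.

(** The quotients [Re z / z] and [i Im z / (z - 1)] lie in the lower half-plane, so in these two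
    cases the representative in [Sigma] is the conjugate. *)
Theorem theorem2p2 (z : C) (hz : Sigma z) :
  (exists w : C,
     (forall u : C, ray 0 z u /\ semicircle u <-> u = w) /\
     W_L z = fold_half w /\ Gamma (W_L z)) /\
  (exists w : C,
     (forall u : C, ray 1 z u /\ semicircle u <-> u = w) /\
     W_R z = fold_half w /\ Gamma (W_R z)) /\
  ((Re z <= Im z)%R -> W_L z = Cconj ((z + Cconj z) / (2 * z))) /\
  ((Re z > Im z)%R -> W_L z = (z - Cconj z) / (2 * z)) /\
  ((1 - Re z <= Im z)%R -> W_R z = (z + Cconj z - 2) / (2 * (z - 1))) /\
  ((1 - Re z > Im z)%R -> W_R z = Cconj ((z - Cconj z) / (2 * (z - 1)))).
Proof.
destruct z as [x y], hz as ((x0 & x1) & y0 & _); simpl in x0, x1, y0.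
assert (s0 : (0 < 1 - x)%R) by lra.
assert (G : forall p q, (0 < p)%R -> (0 < q)%R ->
  Gamma (right_apex (Rmin p q) (Rmax p q))).
{ intros p q p0 q0; apply right_apex_Gamma; split.
  - now apply Rmin_glb_lt.
  - apply Rle_trans with p; [apply Rmin_l|apply Rmax_l]. }
split; [|split; [|repeat split; simpl; intros h]].
- exists (right_apex x y); split; [|split].
  + intros u; now apply ray_0_semicircle.
  + now rewrite fold_half_right_apex, W_L_apex.
  + now rewrite W_L_apex; [apply G| |].
- exists (right_apex y (1 - x)); split; [|split].
  + intros u; now apply ray_1_semicircle.
  + now rewrite fold_half_right_apex, W_R_apex.
  + now rewrite W_R_apex; [apply G| |].
- rewrite W_L_le by lra; complex_field.
- rewrite W_L_ge by lra; complex_field.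
- rewrite W_R_le by lra; complex_field.
- rewrite W_R_ge by lra; complex_field.
Qed.
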